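(* Fix a vehicle index $i$ and a time step $k\in\{1,\dots,N\}$, and let $\alpha\in(0,1)$. For any values of the disturbance samples, consider the following system of constraints in the variables $\vec{U}_i\in\mathcal{U}^N$ and $\lambda=(\lambda_{i1k},\dots,\lambda_{iN_Tk})\in\mathbb{R}^{N_T}$: $$\vec{G}_{ijk}\left(A^k\vec{x}_i(0)+\mathcal{C}(k)\vec{U}_i+\mathcal{D}(k)\hat{\mathbb{E}}[\vec{\boldsymbol{W}}_i]\right)+\lambda_{ijk}\sqrt{\vec{G}_{ijk}\mathcal{D}(k)\hat{\mathrm{Var}}(\vec{\boldsymbol{W}}_i)\mathcal{D}(k)^\top\vec{G}_{ijk}^\top}\le h_{ijk},\quad j=1,\dots,N_T,$$ $$\sum_{j=1}^{N_T}\frac{(\sqrt{N_s+1}+\lambda_{ijk})^2}{\lambda_{ijk}^2N_s+(\sqrt{N_s+1}+\lambda_{ijk})^2}\le\alpha,$$ $$\sqrt{N_s+1}\left[\cos\left(\tfrac13\arccos\left(-\tfrac{N_s-1}{N_s+1}\right)\right)-\tfrac12\right]\le\lambda_{ijk},\quad j=1,\dots,N_T.$$ Then this system is always convex in $\vec{U}_i$ and $\lambda$: on the convex set of all $(\vec{U}_i,\lambda)\in\mathcal{U}^N\times\mathbb{R}^{N_T}$ satisfying the last family of inequalities, the left-hand sides of the first two kinds of constraints are jointly convex functions of $(\vec{U}_i,\lambda)$, so that the set of $(\vec{U}_i,\lambda)\in\mathcal{U}^N\times\mathbb{R}^{N_T}$ satisfying all of the constraints is convex.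
   Context: Setting. Vehicle $i$ evolves by $\vec{\boldsymbol{x}}_i(k+1)=A\vec{\boldsymbol{x}}_i(k)+B\vec{u}_i(k)+\vec{\boldsymbol{w}}_i(k)$ over a horizon of $N$ steps, with $A\in\mathbb{R}^{n\times n}$, $B\in\mathbb{R}^{n\times m}$, known initial state $\vec{x}_i(0)\in\mathbb{R}^n$, inputs $\vec{u}_i(k)\in\mathcal{U}\subseteq\mathbb{R}^m$, where $\mathcal{U}$ is a compact convex polytope, and disturbances $\vec{\boldsymbol{w}}_i(k)\in\mathbb{R}^n$. Stack $\vec{U}_i=[\vec{u}_i(0)^\top\ \cdots\ \vec{u}_i(N-1)^\top]^\top\in\mathcal{U}^N\subseteq\mathbb{R}^{Nm}$ and $\vec{\boldsymbol{W}}_i=[\vec{\boldsymbol{w}}_i(0)^\top\ \cdots\ \vec{\boldsymbol{w}}_i(N-1)^\top]^\top\in\mathbb{R}^{Nn}$, and set $\mathcal{C}(k)=[A^{k-1}B\ \cdots\ AB\ B\ 0_{n\times(N-k)m}]\in\mathbb{R}^{n\times Nm}$ and $\mathcal{D}(k)=[A^{k-1}\ \cdots\ A\ I_n\ 0_{n\times(N-k)n}]\in\mathbb{R}^{n\times Nn}$. The target polytope of vehicle $i$ at time $k$ is $\{x\in\mathbb{R}^n:\vec{G}_{ijk}x\le h_{ijk},\ j=1,\dots,N_T\}$, with row vectors $\vec{G}_{ijk}\in\mathbb{R}^{1\times n}$ and $h_{ijk}\in\mathbb{R}$. Given $N_s\ge2$ samples $\vec{\boldsymbol{W}}_i^{[1]},\dots,\vec{\boldsymbol{W}}_i^{[N_s]}\in\mathbb{R}^{Nn}$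 of the disturbance (fixed values), the sample mean and sample covariance are $\hat{\mathbb{E}}[\vec{\boldsymbol{W}}_i]=\frac1{N_s}\sum_{l=1}^{N_s}\vec{\boldsymbol{W}}_i^{[l]}$ and $\hat{\mathrm{Var}}(\vec{\boldsymbol{W}}_i)=\frac1{N_s}\sum_{l=1}^{N_s}(\vec{\boldsymbol{W}}_i^{[l]}-\hat{\mathbb{E}}[\vec{\boldsymbol{W}}_i])(\vec{\boldsymbol{W}}_i^{[l]}-\hat{\mathbb{E}}[\vec{\boldsymbol{W}}_i])^\top$. *)

(* Defs.v *)
From HB Require Import structures.
From mathcomp Require Import all_boot all_order all_algebra.
From mathcomp Require Import boolp classical_sets reals topology normedtype.
From mathcomp Require Import convex trigo.

Set Implicit Arguments.
Unset Strict Implicit.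
Unset Printing Implicit Defensive.

Import Order.TTheory GRing.Theory Num.Theory.
Import numFieldNormedType.Exports.

Local Open Scope classical_set_scope.
Local Open Scope ring_scope.

(* A stacked vector [v(0)^T ... v(N-1)^T]^T with blocks in R^m has type
   'cV[R]_(\sum_(t < N) m); its block v(t) is [submxcol _ t]. *)

Definition polytope (R : realType) (m : nat) (P : set 'cV[R]_m) : Prop :=
  exists (q : nat) (H : 'M[R]_(q, m)) (b : 'cV[R]_q),
    P = [set u | forall r : 'I_q, (H *m u) r 0 <= b r 0].

(* [A^(k-1) B ... A B  B  0 ... 0] *)
Definition input_mx (R : realType) (n m : nat) (A : 'M[R]_n) (B : 'M[R]_(n, m))
    (N k : nat) : 'M[R]_(n, \sum_(t < N) m) :=
  \mxrow_(t < N) (if (t < k)%N then A ^+ (k - t.+1) *m B else 0 : 'M[R]_(n, m)).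

(* [A^(k-1) ... A  I  0 ... 0] *)
Definition disturbance_mx (R : realType) (n : nat) (A : 'M[R]_n) (N k : nat) :
    'M[R]_(n, \sum_(t < N) n) :=
  \mxrow_(t < N) (if (t < k)%N then A ^+ (k - t.+1) else 0 : 'M[R]_n).

Definition sample_mean (R : realType) (d Ns : nat) (W : 'I_Ns -> 'cV[R]_d) :
    'cV[R]_d :=
  Ns%:R^-1 *: \sum_(l < Ns) W l.

Definition sample_cov (R : realType) (d Ns : nat) (W : 'I_Ns -> 'cV[R]_d) :
    'M[R]_d :=
  Ns%:R^-1 *: \sum_(l < Ns) (W l - sample_mean W) *m (W l - sample_mean W)^T.

Definition decision (R : realType) (N m NT : nat) : lmodType R :=
  ('cV[R]_(\sum_(t < N) m) * 'rV[R]_NT)%type.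

Definition target_lhs (R : realType) (n m N NT Ns k : nat)
    (A : 'M[R]_n) (B : 'M[R]_(n, m)) (x0 : 'cV[R]_n)
    (G : 'I_NT -> 'rV[R]_n) (W : 'I_Ns -> 'cV[R]_(\sum_(t < N) n))
    (j : 'I_NT) (p : decision R N m NT) : R :=
  let D := disturbance_mx A N k in
  (G j *m (A ^+ k *m x0 + input_mx A B N k *m p.1 + D *m sample_mean W)) 0 0
  + p.2 0 j * Num.sqrt ((G j *m D *m sample_cov W *m D^T *m (G j)^T) 0 0).

Definition risk_lhs (R : realType) (N m NT Ns : nat) (p : decision R N m NT) :
    R :=
  let s : R := Num.sqrt (Ns%:R + 1) in
  \sum_(j < NT)
    (s + p.2 0 j) ^+ 2 / (p.2 0 j ^+ 2 * Ns%:R + (s + p.2 0 j) ^+ 2).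

Definition lambda_min (R : realType) (Ns : nat) : R :=
  Num.sqrt (Ns%:R + 1) *
  (cos (3^-1 * acos (- ((Ns%:R - 1) / (Ns%:R + 1)))) - 2^-1).

Definition lambda_domain (R : realType) (N m NT Ns : nat)
    (U : set 'cV[R]_m) : set (decision R N m NT) :=
  [set p : decision R N m NT |
    (forall t : 'I_N, U (submxcol p.1 t)) /\
    (forall j : 'I_NT, lambda_min R Ns <= p.2 0 j)].

Definition feasible (R : realType) (n m N NT Ns k : nat)
    (A : 'M[R]_n) (B : 'M[R]_(n, m)) (x0 : 'cV[R]_n) (U : set 'cV[R]_m)
    (G : 'I_NT -> 'rV[R]_n) (h : 'I_NT -> R)
    (W : 'I_Ns -> 'cV[R]_(\sum_(t < N) n)) (alpha : R) :
    set (decision R N m NT) :=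
  [set p : decision R N m NT |
    [/\ forall t : 'I_N, U (submxcol p.1 t),
        forall j : 'I_NT, target_lhs k A B x0 G W j p <= h j,
        risk_lhs Ns p <= alpha
      & forall j : 'I_NT, lambda_min R Ns <= p.2 0 j]].

(* Main.v *)
Require Import Defs.
From HB Require Import structures.
From mathcomp Require Import all_boot all_order all_algebra.
From mathcomp Require Import boolp classical_sets reals topology normedtype.
From mathcomp Require Import convex trigo.
From mathcomp Require Import interval_inference ring lra.

Set Implicit Arguments.
Unset Strict Implicit.
Unset Printing Implicit Defensive.

Import Order.TTheory GRing.Theory Num.Theory.
Import numFieldNormedType.Exports.

Local Open Scope classical_set_scope.
Local Open Scope ring_scope.
Local Open Scope convex_scope.

(** A target constraint is affine in the decision variables.  In the risk
constraint put [s = sqrt (Ns + 1)], so that the denominator of a summand is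
[q(x) = s^2 x^2 + 2 s x + s^2] and the summand is [1 - Ns x^2 / q(x)].
Subtracting its tangent at [y] leaves
[Ns s^3 (x - y)^2 (2 y (y + s) x + s (y^2 - 1)) / (q(x) q(y)^2)],
and for [x, y >= l >= 0] the last factor of the numerator is at least
[2 l^3 + 3 s l^2 - s].  The triple-angle formula shows that [lambda_min] is a
root of this cubic, so every tangent supports the summand. *)

Lemma conv_lmodE (R : numDomainType) (E : lmodType R) (t : {i01 R})
    (p q : convex_lmodType E) :
  p <| t |> q = t%:num *: (p : E) + (1 - t%:num) *: (q : E).
Proof. by []. Qed.

Lemma conv_regE (R : numDomainType) (t : {i01 R}) (a b : R^o) :
  a <| t |> b = t%:num * a + (1 - t%:num) * b.
Proof. by []. Qed.

Lemma num_itv01 (R : numDomainType) (t : {i01 R}) : 0 <= t%:num <= 1.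
Proof. by rewrite ge0 le1. Qed.

Lemma convex_function_sublevel (R : realType) (E : lmodType R)
    (D : set (convex_lmodType E)) (f : convex_lmodType E -> R^o) (c : R) p q t :
    convex_function D f -> p \in D -> q \in D -> f p <= c -> f q <= c ->
  f (p <| t |> q) <= c.
Proof.
move=> fconvex pD qD pc qc; apply: le_trans (fconvex t p q pD qD) _.
rewrite conv_regE; have /andP[] := num_itv01 t.
nra.
Qed.

(** Take the supporting line at the combination [z], evaluate it at [x] and [y], and average: the
    slope terms cancel. [f'] may be any choice of slopes. *)
Lemma le_conv_of_tangent (R : realType) (f f' : R -> R) (a x y t : R) :
    (forall u v, a <= u -> a <= v -> f v + f' v * (u - v) <= f u) ->
    0 <= t <= 1 -> a <= x -> a <= y ->
  f (t * x + (1 - t) * y) <= t * f x + (1 - t) * f y.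
Proof.
move=> ftan /andP[t0 t1] ax ay; set z := t * x + _.
have az : a <= z by rewrite /z; nra.
have := ler_wpM2l t0 (ftan x z ax az).
have t1' : 0 <= 1 - t by lra.
have := ler_wpM2l t1' (ftan y z ay az).
have : t * (f' z * (x - z)) + (1 - t) * (f' z * (y - z)) = 0 by rewrite /z; ring.
nra.
Qed.

Lemma cos_third (R : realType) (x : R) :
  cos x = 4 * cos (3^-1 * x) ^+ 3 - 3 * cos (3^-1 * x).
Proof.
set y := 3^-1 * x; have -> : x = y *+ 2 + y by rewrite /y; field.
rewrite cosD cos_mulr2n sin_mulr2n.
transitivity (2 * cos y ^+ 3 - cos y - 2 * cos y * sin y ^+ 2); first by ring.
by rewrite sin2cos2; ring.
Qed.

(** At [pi] the triple-angle formula reads [4 c^3 - 3 c + 1 = (c + 1) (2 c - 1)^2 = 0], and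
    positivity of [c] excludes [-1]. *)
Lemma cos_pi_third (R : realType) : cos (3^-1 * pi) = 2^-1 :> R.
Proof.
have pi0 := pi_gt0 R.
have c0 : 0 < cos (3^-1 * pi) :> R by apply: cos_gt0_pihalf; lra.
have := cos_third (pi : R); rewrite cospi; set c := cos _ in c0 * => cE.
have /eqP : (c + 1) * (2 * c - 1) ^+ 2 = 0 by lra.
by rewrite mulf_eq0 sqrf_eq0 => /orP[] /eqP; lra.
Qed.

Section lambda_min.
Variables (R : realType) (Ns : nat).

Let acos_arg : R := - ((Ns%:R - 1) / (Ns%:R + 1)).

Let acos_arg_itv : -1 <= acos_arg <= 1.
Proof.
have n0 := ler0n R Ns.
have n1 : 0 < Ns%:R + 1 :> R by lra.
rewrite /acos_arg lerNr opprK lerNl.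
by rewrite ler_pdivrMr// ler_pdivlMr//; apply/andP; split; lra.
Qed.

(** A third of an [acos] value lies in [[0, pi/3]], where the decreasing cosine is at least
    [1/2]. *)
Lemma lambda_min_ge0 : 0 <= lambda_min R Ns.
Proof.
rewrite /lambda_min -/acos_arg mulr_ge0 ?sqrtr_ge0// subr_ge0 -cos_pi_third.
have [/andP[th0 thpi] _] := acos_def acos_arg_itv.
have pi0 := pi_gt0 R.
by rewrite leNgt ltr_cos ?in_itv/=; [lra | apply/andP; split; lra..].
Qed.

(** With [l = s (c - 1/2)] the left side becomes [s^3 (4 c^3 - 3 c + 1) / 2]. The triple-angle
    formula turns the bracket into [acos_arg + 1 = 2 / s^2]. *)
Lemma lambda_minE (l := lambda_min R Ns) (s : R := Num.sqrt (Ns%:R + 1)) :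
  2 * l ^+ 3 + 3 * s * l ^+ 2 = s.
Proof.
rewrite {}/l /lambda_min -/s -/acos_arg.
have n0 := ler0n R Ns.
have s2 : s ^+ 2 = Ns%:R + 1 by rewrite sqr_sqrtr// addr_ge0.
have [_ cth] := acos_def acos_arg_itv.
have := cos_third (acos acos_arg); rewrite cth; set c := cos _ => cE.
transitivity (s * s ^+ 2 * (((4 * c ^+ 3 - 3 * c) + 1) / 2)); first by field.
rewrite -cE /acos_arg s2; field; lra.
Qed.

End lambda_min.

(** The slope is the derivative of [1 - n z^2 / q z] at [y]: the cubic terms of [2 z q - z^2 q']
    cancel, leaving [2 s z (z + s)]. *)
Lemma risk_term_tangent (R : realType) (n s l x y : R)
    (q := fun z : R => z ^+ 2 * n + (s + z) ^+ 2) :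
    0 <= n -> 0 < s -> s ^+ 2 = n + 1 -> 0 <= l ->
    2 * l ^+ 3 + 3 * s * l ^+ 2 = s -> l <= x -> l <= y ->
  (s + y) ^+ 2 / q y - 2 * n * s * y * (y + s) / q y ^+ 2 * (x - y)
    <= (s + x) ^+ 2 / q x.
Proof.
move=> n0 s0 s2 l0 lE lx ly.
have q_gt0 z : l <= z -> 0 < q z by rewrite /q => lz; nra.
have [qx0 qy0] := (q_gt0 x lx, q_gt0 y ly).
have nE : n = s ^+ 2 - 1 by lra.
pose r := 2 * y * (y + s) * x + s * (y ^+ 2 - 1).
have r0 : 0 <= r.
  (* Each monomial of [r] is monotone in [x] and [y], so both may be lowered to [l], where [r]
     vanishes by [lE]. *)
  have y2 : l ^+ 2 <= y ^+ 2 by nra.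
  have yyx : l * (l + s) * l <= y * (y + s) * x.
    apply: ler_pM => //; first nra.
    by apply: ler_pM => //; lra.
  have : 0 <= s * (y ^+ 2 - l ^+ 2) by apply: mulr_ge0; lra.
  by rewrite /r; lra.
rewrite -subr_ge0.
suff -> : (s + x) ^+ 2 / q x - ((s + y) ^+ 2 / q y
    - 2 * n * s * y * (y + s) / q y ^+ 2 * (x - y))
    = n * s ^+ 3 * (x - y) ^+ 2 * r / (q x * q y ^+ 2).
  apply: divr_ge0; last by rewrite ltW ?mulr_gt0 ?exprn_gt0.
  have ns3 : 0 <= n * s ^+ 3 by rewrite mulr_ge0 ?exprn_ge0 ?(ltW s0).
  exact: mulr_ge0 (mulr_ge0 ns3 (sqr_ge0 _)) r0.
have {}qx0 := lt0r_neq0 qx0; have {}qy0 := lt0r_neq0 qy0.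
(* The identity depends on [s^2 = n + 1]; eliminating [n] makes it one of rational functions in [s],
   [x], [y]. *)
move: qx0 qy0; rewrite /q /r nE => qx0 qy0; field.
by rewrite qx0 qy0.
Qed.

Lemma convex_polytope (R : realType) (m : nat) (P : set 'cV[R]_m) :
  polytope P -> convex_set P.
Proof.
move=> [q [H [b ->]]] u v t; rewrite !inE /= => Hu Hv r.
rewrite conv_lmodE mulmxDr -!scalemxAr mxE [X in X + _]mxE [X in _ + X]mxE.
have := Hu r; have := Hv r; have /andP[] := num_itv01 t.
nra.
Qed.

Lemma convex_lambda_domain (R : realType) (N m NT Ns : nat)
    (U : set 'cV[R]_m) :
  convex_set U -> convex_set (@lambda_domain R N m NT Ns U).
Proof.
move=> U_convex p q t; rewrite !inE /= => -[pU pl] [qU ql]; split=> [i|j].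
  have /= := U_convex _ _ t (mem_set (pU i)) (mem_set (qU i)).
  rewrite inE; congr U.
  by apply/matrixP=> r c; rewrite conv_lmodE !mxE.
rewrite conv_lmodE !mxE.
have := pl j; have := ql j; have /andP[] := num_itv01 t.
nra.
Qed.

Lemma convex_target_lhs (R : realType) (n m N NT Ns k : nat)
    (A : 'M[R]_n) (B : 'M[R]_(n, m)) (x0 : 'cV[R]_n)
    (G : 'I_NT -> 'rV[R]_n) (W : 'I_Ns -> 'cV[R]_(\sum_(t < N) n))
    (j : 'I_NT) (D : set (decision R N m NT)) :
  convex_function D (target_lhs k A B x0 G W j).
Proof.
move=> t p q _ _; rewrite /target_lhs.
(* Neither term depends on the decision variables, so the rest is affine in them. *)
set c := Num.sqrt _; set d := _ *m sample_mean W.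
rewrite conv_lmodE conv_regE /= !(mulmxDr, =^~ scalemxAr) !mxE; lra.
Qed.

Lemma convex_risk_lhs (R : realType) (N m NT Ns : nat) (U : set 'cV[R]_m) :
  convex_function (lambda_domain Ns U) (@risk_lhs R N m NT Ns).
Proof.
move=> t p q; rewrite !inE /= => -[_ pl] [_ ql].
rewrite conv_regE conv_lmodE /risk_lhs !mulr_sumr -big_split/=.
(* Each summand involves a single coordinate of [lambda], so one-variable convexity suffices. *)
apply: ler_sum => j _; rewrite !mxE.
have n0 := ler0n R Ns; set s := Num.sqrt _.
have s0 : 0 < s by rewrite sqrtr_gt0; lra.
have s2 : s ^+ 2 = Ns%:R + 1 by rewrite sqr_sqrtr// addr_ge0.
pose f z : R := (s + z) ^+ 2 / (z ^+ 2 * Ns%:R + (s + z) ^+ 2).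
pose f' z : R :=
  - (2 * Ns%:R * s * z * (z + s) / (z ^+ 2 * Ns%:R + (s + z) ^+ 2) ^+ 2).
apply: (@le_conv_of_tangent _ f f' _ _ _ _ _ _ (pl j) (ql j)).
  move=> u v lu lv; rewrite mulNr.
  exact: risk_term_tangent n0 s0 s2 (lambda_min_ge0 R Ns) (lambda_minE R Ns) lu lv.
exact: num_itv01.
Qed.

Theorem lemma1 (R : realType) (n m N NT Ns k : nat)
    (A : 'M[R]_n) (B : 'M[R]_(n, m)) (x0 : 'cV[R]_n)
    (U : set 'cV[R]_m) (U_polytope : polytope U) (U_compact : compact U)
    (G : 'I_NT -> 'rV[R]_n) (h : 'I_NT -> R) (alpha : R)
    (k_range : (1 <= k <= N)%N) (alpha_range : 0 < alpha < 1)
    (Ns_ge2 : (2 <= Ns)%N) (W : 'I_Ns -> 'cV[R]_(\sum_(t < N) n)) :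
  [/\ convex_set (@lambda_domain R N m NT Ns U),
      forall j : 'I_NT,
        convex_function (lambda_domain Ns U) (target_lhs k A B x0 G W j),
      convex_function (lambda_domain Ns U) (@risk_lhs R N m NT Ns)
    & convex_set (feasible k A B x0 U G h W alpha)].

Proof.
have domain_convex : convex_set (@lambda_domain R N m NT Ns U).
  exact/convex_lambda_domain/convex_polytope.
have target_convex j :
    convex_function (lambda_domain Ns U) (target_lhs k A B x0 G W j).
  exact: convex_target_lhs.
have risk_convex := @convex_risk_lhs R N m NT Ns U.
split => // p q t.
rewrite !inE => -[pU ph pa pl] [qU qh qa ql].
have pD : p \in lambda_domain Ns U by rewrite inE.
have qD : q \in lambda_domain Ns U by rewrite inE.
(* This settles the input and lower-bound constraints; the other two are sublevel conditions of
   convex functions. *)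
have := domain_convex p q t pD qD; rewrite inE => -[zU zl].
split => // [j|].
- exact: (convex_function_sublevel t (target_convex j)).
- exact: (convex_function_sublevel t risk_convex).
Qed.
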